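(* Let $n\ge 3$ be an integer, $0<m<\frac{n-2}{n}$, $\gamma>0$ with $\gamma\ne\frac{2}{1-m}$, and $\eta>0$. Let $\alpha\in\mathbb{R}$ and $\beta\in\mathbb{R}\setminus\{0\}$ satisfy $$\alpha=\frac{2\beta+1}{1-m}.$$ Suppose there exists a radially symmetric solution $f$ of $$\Delta (f^m/m)+\alpha f+\beta x\cdot\nabla f=0,\quad f>0,\quad\text{ in }\mathbb{R}^n\setminus\{0\}$$ which satisfies $$\lim_{|x|\to 0}|x|^{\gamma}f(x)=\eta.$$ Then $$\alpha>0\quad\text{ and }\quad\beta>0.$$
   Context: ''Solution'' means a classical (twice continuously differentiable) positive function satisfying the equation pointwise on $\mathbb{R}^n\setminus\{0\}$. Radially symmetric means that $f(x)$ depends only on $|x|$. *)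

(* Defs.v *)
From HB Require Import structures.
From mathcomp Require Import all_boot all_order all_algebra.
From mathcomp Require Import all_classical all_reals all_analysis.

Set Implicit Arguments.
Unset Strict Implicit.
Unset Printing Implicit Defensive.

Import Order.TTheory GRing.Theory Num.Theory.
Import numFieldNormedType.Exports.

Local Open Scope classical_set_scope.
Local Open Scope ring_scope.

(* The space R^n is ['rV[R]_n].  The library norm [`|x|] on it is the sup norm:
   it defines the usual topology but is not the Euclidean length, hence
   [enorm].  Functions on R^n \ {0} are represented by total functions whose
   value at the origin is never used. *)

Definition dotp (R : realType) (n : nat) (x y : 'rV[R]_n) : R :=
  \sum_(i < n) x 0 i * y 0 i.

Definition enorm (R : realType) (n : nat) (x : 'rV[R]_n) : R :=
  Num.sqrt (dotp x x).

Definition punctured (R : realType) (n : nat) : set 'rV[R]_n :=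
  [set x | x != 0].

Definition partial (R : realType) (n : nat) (i : 'I_n) (f : 'rV[R]_n -> R) :
  'rV[R]_n -> R := fun x => 'D_(delta_mx 0 i) f x.

Definition grad (R : realType) (n : nat) (f : 'rV[R]_n -> R) (x : 'rV[R]_n) :
  'rV[R]_n := \row_(i < n) partial i f x.

Definition laplacian (R : realType) (n : nat) (f : 'rV[R]_n -> R)
  (x : 'rV[R]_n) : R := \sum_(i < n) partial i (partial i f) x.

(* Twice continuous differentiability on U, meant for open U: every partial
   derivative of order at most 2 exists and is continuous at each point of U.
   The existence clauses are needed because ['D_v f x] is total. *)
Definition C2_on (R : realType) (n : nat) (U : set 'rV[R]_n)
  (f : 'rV[R]_n -> R) : Prop :=
  forall x, U x ->
    {for x, continuous f} /\
    forall i : 'I_n,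
      [/\ derivable f x (delta_mx 0 i),
          {for x, continuous (partial i f)} &
          forall j : 'I_n,
            derivable (partial i f) x (delta_mx 0 j) /\
            {for x, continuous (partial j (partial i f))}].

Definition radial_on (R : realType) (n : nat) (U : set 'rV[R]_n)
  (f : 'rV[R]_n -> R) : Prop :=
  forall x y, U x -> U y -> enorm x = enorm y -> f x = f y.

Definition is_solution (R : realType) (n : nat) (m alpha beta : R)
  (f : 'rV[R]_n -> R) : Prop :=
  [/\ C2_on (@punctured R n) f,
      forall x, punctured x -> 0 < f x &
      forall x, punctured x ->
        laplacian (fun y => f y `^ m / m) x + alpha * f x
          + beta * dotp x (grad f x) = 0].

(* Main.v *)
Require Import Defs.
From HB Require Import structures.
From mathcomp Require Import all_boot all_order all_algebra.
From mathcomp Require Import all_classical all_reals all_analysis.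
From mathcomp Require Import ring lra.

Set Implicit Arguments.
Unset Strict Implicit.
Unset Printing Implicit Defensive.

Import Order.TTheory GRing.Theory Num.Theory.
Import numFieldNormedType.Exports.

Local Open Scope classical_set_scope.
Local Open Scope ring_scope.

(** Why it holds.  A radial solution is a profile [h] of r = |x|, and with
    H = h^m / m the equation reads

      H'' + (n - 1) / r H' + alpha h + beta r h' = 0    (r > 0).

    In the logarithmic variable t = ln r, with q(t) = h(e^t) and v = q^m / m, it
    becomes v'' + (n - 2) v' + e^(2t) (alpha q + beta q') = 0, and the assumption
    on the singularity says that e^(gamma t) q tends to [eta], hence
    e^(gamma m t) v to eta^m / m, as t tends to -oo.

    For every exponent lam, the flux
      P = e^(lam t) v' + (n - 2 - lam) e^(lam t) v + beta e^((2 + lam) t) q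
    has a derivative without v' and q':
      P' = lam (n - 2 - lam) e^(lam t) v
           + ((2 + lam) beta - alpha) e^((2 + lam) t) q.
    If e^(lam t) v and e^((2 + lam) t) q converge at -oo, so does P'.  Its limit
    has to be zero: otherwise P would be unbounded linearly, and so would the
    derivative of e^(lam t) v, which is P up to a bounded term; but
    e^(lam t) v is bounded ([flux_limit_eq0]).

    Two choices of lam finish the proof ([ode_exponents]).
    - If gamma < 2 / (1 - m), diffusion dominates near the origin: with
      lam = gamma m the term in q tends to 0, and one gets gamma m = n - 2 (the
      exponent of the fundamental solution), which is incompatible with
      gamma < 2 / (1 - m) because m < (n - 2) / n.
    - If gamma > 2 / (1 - m), the first-order terms dominate: with
      lam = gamma - 2 the term in v tends to 0, and one gets
      alpha = gamma beta.
    So gamma > 2 / (1 - m) and alpha = gamma beta.  Together with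
    alpha (1 - m) = 2 beta + 1 this gives beta (gamma (1 - m) - 2) = 1, whence
    beta > 0, and then alpha = gamma beta > 0. *)

(** * Behaviour at -oo of functions with a prescribed derivative *)

Lemma le_affine_of_derive_ge (R : realType) (f df : R -> R) (T c : R) :
  (forall t, is_derive t (1 : R) f (df t)) -> (forall t, t <= T -> c <= df t) ->
  forall t, t <= T -> f t <= f T - c * (T - t).
Proof.
move=> dff dfc t tT.
have cf : {within `[t, T], continuous f}.
  apply: continuous_subspaceT => x.
  by apply: differentiable_continuous; apply/derivable1_diffP; case: (dff x).
have [x + e] := @MVT_segment R f df t T tT (fun x _ => dff x) cf.
rewrite in_itv /= => /andP[_ xT].
suff : c * (T - t) <= df x * (T - t) by rewrite -e; lra.
by apply: ler_wpM2r; [rewrite subr_ge0|exact: dfc].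
Qed.

(** The engine of the proof.  Read from T towards -oo, P decreases at least
    linearly; so does [dw], which stays within C of P, and then [w] cannot be
    bounded. *)
Lemma no_escape_at_ninfty (R : realType) (P dP w dw : R -> R) (T C eps : R) :
  0 < eps ->
  (forall t, is_derive t (1 : R) P (dP t)) ->
  (forall t, is_derive t (1 : R) w (dw t)) ->
  (forall t, t <= T -> eps <= dP t) ->
  (forall t, t <= T -> `|dw t - P t| <= C) ->
  (forall t, t <= T -> `|w t| <= C) ->
  False.
Proof.
move=> eps0 dPP dww dPeps dwC wC.
have P_le := le_affine_of_derive_ge dPP dPeps.
(* The point below which the linear bound forces P <= - C - 1. *)
pose T' := Num.min T (T - (P T + C + 1) / eps).
have T'T : T' <= T by rewrite /T' ge_min lexx.
have dw_le t : t <= T' -> dw t <= -1.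
  move=> tT'; have tT := le_trans tT' T'T.
  have : t <= T - (P T + C + 1) / eps.
    by apply: le_trans tT' _; rewrite /T' ge_min lexx orbT.
  rewrite lerBrDr -lerBrDl ler_pdivrMr// => h1.
  have := P_le _ tT; have := dwC _ tT; rewrite ler_norml => /andP[_]; lra.
(* Below T' the slope of w is at most -1, so going back by 2 C + 1 raises w by
   at least that much, more than the range [-C, C] allows. *)
have T'0 : T' - (2 * C + 1) <= T'.
  have : 0 <= C by apply: le_trans (wC _ (lexx T)).
  lra.
have dNw t : is_derive t (1 : R) (- w) (- dw t) by apply: is_deriveN.
have wT' t : t <= T' -> - w t <= - w T' - 1 * (T' - t).
  apply: (le_affine_of_derive_ge dNw) => s /dw_le.
  by rewrite lerNr.
have := wT' _ T'0; have := wC _ T'T; have := wC _ (le_trans T'0 T'T).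
by rewrite !ler_norml => /andP[h1 h2] /andP[h3 h4]; lra.
Qed.

Global Instance is_derive_expRZ (R : realType) (c t : R) :
  is_derive t (1 : R) (fun s => expR (c * s)) (c * expR (c * t)).
Proof.
have -> : (fun s => expR (c * s)) = expR \o (c *: (@idfun R)).
  by apply/funext => s.
rewrite mulrC; apply: is_derive1_comp.
by apply: is_derive_eq; rewrite /GRing.scale/= mulr1.
Qed.

Lemma cvg_expRZ_ninfty (R : realType) (c : R) : 0 < c ->
  expR (c * t) @[t --> -oo] --> (0 : R).
Proof.
move=> c0; apply/cvgrPdist_le => e e0.
near=> t; rewrite sub0r normrN gtr0_norm ?expR_gt0//.
by rewrite -(lnK e0) ler_expR -ler_pdivlMl//.
Unshelve. all: by end_near. Qed.

Lemma cvg_ninfty_bounded (R : realType) (w : R -> R) (W : R) :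
  w t @[t --> -oo] --> W -> \forall t \near -oo, `|w t| <= `|W| + 1.
Proof.
move=> /cvgrPdist_le/(_ 1 ltr01); apply: filterS => t h.
have := ler_normD (w t - W) W; rewrite subrK distrC in h *; lra.
Qed.

(** * The equation in the logarithmic variable *)

(** Here [P] is the flux e^(lam t) v' + (N - lam) e^(lam t) v
    + beta e^((2 + lam) t) q; the equation turns its derivative [dP] into a
    combination of the two convergent quantities.  A positive limit of [dP] is
    excluded by [no_escape_at_ninfty], since the derivative of e^(lam t) v
    differs from [P] by a bounded term. *)
Lemma flux_limit_le0 (R : realType) (N lam alpha beta A B : R)
    (q q1 v v1 v2 : R -> R) :
  (forall t, is_derive t (1 : R) q (q1 t)) ->
  (forall t, is_derive t (1 : R) v (v1 t)) ->
  (forall t, is_derive t (1 : R) v1 (v2 t)) ->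
  (forall t, v2 t + N * v1 t
     + expR (2 * t) * (alpha * q t + beta * q1 t) = 0) ->
  expR (lam * t) * v t @[t --> -oo] --> A ->
  expR ((2 + lam) * t) * q t @[t --> -oo] --> B ->
  lam * (N - lam) * A + ((2 + lam) * beta - alpha) * B <= 0.
Proof.
move=> dq dv dv1 ode wA yB; rewrite leNgt; apply/negP.
set L := (X in 0 < X) => L0.
pose w t := expR (lam * t) * v t.
pose y t := expR ((2 + lam) * t) * q t.
pose P t := expR (lam * t) * v1 t + (N - lam) * w t + beta * y t.
pose dP t := lam * (N - lam) * w t + ((2 + lam) * beta - alpha) * y t.
have dexpM c (g g1 : R -> R) t : is_derive t (1 : R) g (g1 t) ->
    is_derive t (1 : R) (fun t => expR (c * t) * g t)
      (expR (c * t) * g1 t + c * (expR (c * t) * g t)).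
  move=> dg; apply: (@is_derive_eq R R R (fun t => expR (c * t) * g t)).
  by rewrite /GRing.scale /=; ring.
have dPP t : is_derive t (1 : R) P (dP t).
  have h := is_deriveD (is_deriveD (dexpM lam v1 v2 t (dv1 t))
    (is_deriveZ (N - lam) (dexpM lam v v1 t (dv t))))
    (is_deriveZ beta (dexpM (2 + lam) q q1 t (dq t))).
  apply: (is_derive_eq h); rewrite /dP /w /y /GRing.scale /=.
  have -> : v2 t = - (N * v1 t)
      - expR (2 * t) * (alpha * q t + beta * q1 t) by have := ode t; lra.
  have -> : expR ((2 + lam) * t) = expR (2 * t) * expR (lam * t).
    by rewrite -expRD -mulrDl.
  ring.
have dPL : dP t @[t --> -oo] --> L.
  by apply: cvgD; apply: cvgM => //; exact: cvg_cst.
pose C := (`|lam - (N - lam)| + 1) * (`|A| + 1) + `|beta| * (`|B| + 1).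
have : \forall t \near -oo,
    [/\ `|w t| <= `|A| + 1, `|y t| <= `|B| + 1 & L / 2 <= dP t].
  near=> t; split.
  - by near: t; exact: cvg_ninfty_bounded.
  - by near: t; exact: cvg_ninfty_bounded.
  - near: t; move/cvgrPdist_le: dPL => /(_ (L / 2)).
    rewrite divr_gt0// => /(_ isT); apply: filterS => t.
    by rewrite ler_norml => /andP[_]; lra.
case=> T [_ HT].
have {}HT t : t <= T - 1 ->
    [/\ `|w t| <= `|A| + 1, `|y t| <= `|B| + 1 & L / 2 <= dP t].
  by move=> tT; apply: HT; lra.
apply: (@no_escape_at_ninfty R P dP w _ (T - 1) C (L / 2) _ dPP
  (fun t => dexpM lam v v1 t (dv t))).
- by rewrite divr_gt0.
- by move=> t /HT[].
- move=> t /HT[wt yt _].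
  have -> : expR (lam * t) * v1 t + lam * (expR (lam * t) * v t) - P t
      = (lam - (N - lam)) * w t - beta * y t.
    by rewrite /P /w /y; ring.
  apply: le_trans (ler_normB _ _) _.
  rewrite /C (normrM (_ - _)) (normrM beta).
  by apply: lerD; apply: ler_pM => //; rewrite lerDl.
- move=> t /HT[wt _ _]; apply: le_trans wt _; rewrite /C.
  have := normr_ge0 (lam - (N - lam)); have := normr_ge0 A.
  have := normr_ge0 beta; have := normr_ge0 B; nra.
Unshelve. all: by end_near. Qed.

(** The equation is linear in the pair (q, v), so the one-sided bound also
    applies to (- q, - v); for this reason q and v are kept independent,
    without the relation v = q^m / m. *)
Lemma flux_limit_eq0 (R : realType) (N lam alpha beta A B : R)
    (q q1 v v1 v2 : R -> R) :
  (forall t, is_derive t (1 : R) q (q1 t)) ->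
  (forall t, is_derive t (1 : R) v (v1 t)) ->
  (forall t, is_derive t (1 : R) v1 (v2 t)) ->
  (forall t, v2 t + N * v1 t
     + expR (2 * t) * (alpha * q t + beta * q1 t) = 0) ->
  expR (lam * t) * v t @[t --> -oo] --> A ->
  expR ((2 + lam) * t) * q t @[t --> -oo] --> B ->
  lam * (N - lam) * A + ((2 + lam) * beta - alpha) * B = 0.
Proof.
move=> dq dv dv1 ode wA yB; apply/eqP; rewrite eq_le.
rewrite (flux_limit_le0 dq dv dv1 ode wA yB)/= -oppr_le0 opprD -!mulrN.
apply: (@flux_limit_le0 R N lam alpha beta (- A) (- B)
  (- q) (fun t => - q1 t) (- v) (fun t => - v1 t) (fun t => - v2 t)) => //.
- move=> t; have := ode t; rewrite -[(- q) t]/(- q t) => o.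
  by rewrite -[RHS]oppr0 -o; ring.
- by under eq_fun do rewrite mulrN; exact: cvgN.
- by under eq_fun do rewrite mulrN; exact: cvgN.
Qed.

Lemma cvg_expRM_ninfty0 (R : realType) (a b : R) (g : R -> R) (G : R) :
  a < b -> expR (a * t) * g t @[t --> -oo] --> G ->
  expR (b * t) * g t @[t --> -oo] --> (0 : R).
Proof.
move=> ab gG.
have -> : (fun t => expR (b * t) * g t)
    = (fun t => expR ((b - a) * t) * (expR (a * t) * g t)).
  by apply/funext => t; rewrite mulrA -expRD -mulrDl subrK.
rewrite -(mul0r G); apply: cvgM gG.
by apply: cvg_expRZ_ninfty; rewrite subr_gt0.
Qed.

(** Scaling dichotomy.  The diffusion terms are of size e^(- gam m t) and the
    first-order ones of size e^((2 - gam) t): the sign of gam - 2 / (1 - m)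
    decides which of them dominate at -oo, and [lam] is chosen so as to
    normalise the dominant ones. *)
Lemma ode_exponents (R : realType) (N m gam alpha beta W Y : R)
    (q q1 v v1 v2 : R -> R) :
  0 < m < 1 -> 0 < gam -> 2 * m < N * (1 - m) -> gam != 2 / (1 - m) ->
  W != 0 -> Y != 0 ->
  (forall t, is_derive t (1 : R) q (q1 t)) ->
  (forall t, is_derive t (1 : R) v (v1 t)) ->
  (forall t, is_derive t (1 : R) v1 (v2 t)) ->
  (forall t, v2 t + N * v1 t
     + expR (2 * t) * (alpha * q t + beta * q1 t) = 0) ->
  expR (gam * m * t) * v t @[t --> -oo] --> W ->
  expR (gam * t) * q t @[t --> -oo] --> Y ->
  2 / (1 - m) < gam /\ alpha = gam * beta.
Proof.
move=> /andP[m0 m1] gam0 mN gamE W0 Y0 dq dv dv1 ode wW yY.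
have m10 : 0 < 1 - m by rewrite subr_gt0.
have [glt|ggt|gE] := ltgtP gam (2 / (1 - m)); last by rewrite gE eqxx in gamE.
(* Diffusion dominates; the limit forces gam m = N. *)
- exfalso; move: glt; rewrite ltr_pdivlMr// => glt.
  have glt' : gam < 2 + gam * m by lra.
  have := flux_limit_eq0 dq dv dv1 ode wW (cvg_expRM_ninfty0 glt' yY).
  rewrite mulr0 addr0 => /eqP.
  rewrite !mulf_eq0 (negPf W0) orbF (gt_eqF gam0) (gt_eqF m0) /=.
  by rewrite subr_eq0 => /eqP Ngm; nra.
(* The first-order terms dominate. *)
- split => //; move: ggt; rewrite ltr_pdivrMr// => ggt.
  have ggt' : gam * m < gam - 2 by lra.
  have gE2 : 2 + (gam - 2) = gam by ring.
  have := @flux_limit_eq0 R N (gam - 2) alpha beta 0 Y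
    q q1 v v1 v2 dq dv dv1 ode (cvg_expRM_ninfty0 ggt' wW).
  rewrite gE2 => /(_ yY) /eqP.
  rewrite mulr0 add0r mulf_eq0 (negPf Y0) orbF subr_eq0 => /eqP.
  by move=> ->.
Qed.

(** * Derivatives along lines and calculus of radial functions *)

Section Line.
Context {R : realType} {V W : normedModType R}.

Lemma line_derivativeE (F : V -> W) (x v : V) (s : R) :
  (fun h : R => h^-1 *: (((fun t : R => F (t *: v + x)) \o shift s) (h *: 1)
     - F (s *: v + x))) =
  (fun h : R => h^-1 *: ((F \o shift (s *: v + x)) (h *: v) - F (s *: v + x))).
Proof.
apply/funext => h /=; rewrite scalerDl addrA.
by congr (_ *: (F (_ *: _ + _ + _) - _)); rewrite /GRing.scale /= mulr1.
Qed.

(** A directional derivative is an ordinary one of the restriction to a line: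
    the two difference quotients coincide.  This brings partial derivatives
    within reach of the one-variable chain rule. *)
Lemma is_derive_line (F : V -> W) (x v : V) (s : R) (d : W) :
  is_derive s (1 : R) (fun t : R => F (t *: v + x)) d
  <-> is_derive (s *: v + x) v F d.
Proof.
split=> -[ex de]; split.
- by rewrite /derivable -line_derivativeE.
- by rewrite -de /derive -line_derivativeE.
- by rewrite /derivable line_derivativeE.
- by rewrite -de /derive line_derivativeE.
Qed.

Lemma is_derive_line0 (F : V -> W) (x v : V) (d : W) :
  is_derive (0 : R) (1 : R) (fun t : R => F (t *: v + x)) d
  <-> is_derive x v F d.
Proof. by rewrite is_derive_line scale0r add0r. Qed.

End Line.

Section Radial.
Context {R : realType} {n : nat}.
Implicit Types (x y : 'rV[R]_n) (i : 'I_n).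

Lemma dotpp_ge0 x : 0 <= dotp x x.
Proof. by apply: sumr_ge0 => i _; rewrite -expr2 sqr_ge0. Qed.

Lemma enorm_sqr x : enorm x ^+ 2 = dotp x x.
Proof. by rewrite /enorm sqr_sqrtr// dotpp_ge0. Qed.

Lemma dotpp_gt0 x : x != 0 -> 0 < dotp x x.
Proof.
move=> x0; rewrite lt_neqAle dotpp_ge0 andbT eq_sym.
apply: contra x0; rewrite psumr_eq0; last by move=> i _; rewrite -expr2 sqr_ge0.
move=> /allP xi0; apply/eqP/rowP => i; rewrite mxE.
by have := xi0 i (mem_index_enum i); rewrite mulf_eq0 orbb => /eqP.
Qed.

Lemma enorm_gt0 x : x != 0 -> 0 < enorm x.
Proof. by move=> x0; rewrite /enorm sqrtr_gt0 dotpp_gt0. Qed.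

Lemma enorm_line x i (s : R) :
  enorm (s *: delta_mx 0 i + x) = Num.sqrt (dotp x x + 2 * x 0 i * s + s * s).
Proof.
rewrite /enorm; congr Num.sqrt; rewrite /dotp.
rewrite (bigD1 i)//= [in RHS](bigD1 i)//=.
under eq_bigr => j ji do rewrite !mxE (negPf ji) /= mulr0 !add0r.
by rewrite !mxE !eqxx /=; ring.
Qed.

Lemma enorm_axis i (s : R) : 0 < s -> enorm (s *: delta_mx 0 i : 'rV[R]_n) = s.
Proof.
move=> s0; rewrite -[_ *: _]addr0 enorm_line mxE mulr0 mul0r addr0.
rewrite /dotp big1 ?add0r; last by move=> j _; rewrite mxE mul0r.
by rewrite -expr2 sqrtr_sqr gtr0_norm.
Qed.

Lemma axis_neq0 i (s : R) : 0 < s -> s *: delta_mx 0 i != 0 :> 'rV[R]_n.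
Proof.
move=> s0; apply: contraTneq s0 => /rowP/(_ i); rewrite !mxE !eqxx mulr1 => ->.
by rewrite ltxx.
Qed.

Lemma is_derive_enorm x i : x != 0 ->
  is_derive x (delta_mx 0 i) (@enorm R n) (x 0 i / enorm x).
Proof.
move=> x0; apply/is_derive_line0.
under eq_fun do rewrite enorm_line.
pose p (s : R) := dotp x x + 2 * x 0 i * s + s * s.
have dp : is_derive (0 : R) (1 : R) p (2 * x 0 i).
  apply: (@is_derive_eq R R R (fun s => dotp x x + 2 * x 0 i * s + s * s)).
  by rewrite /GRing.scale /=; ring.
have p0 : p 0 = dotp x x by rewrite /p; ring.
have ds : is_derive (p 0) (1 : R) Num.sqrt (2 * enorm x)^-1.
  by rewrite p0; apply: is_derive1_sqrt; exact: dotpp_gt0.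
apply: (is_derive_eq (is_derive1_comp ds dp)).
by field; rewrite gt_eqF// enorm_gt0.
Qed.

Lemma is_derive_coord x i j :
  is_derive x (delta_mx 0 i) (fun y => y 0 j) ((i == j)%:R : R).
Proof.
apply/is_derive_line0.
have -> : (fun t : R => (t *: delta_mx 0 i + x) 0 j)
    = (fun t : R => t * (i == j)%:R + x 0 j).
  by apply/funext => t; rewrite !mxE eqxx /= eq_sym.
apply: (@is_derive_eq R R R (fun t => t * (i == j)%:R + x 0 j)).
by rewrite /GRing.scale /=; ring.
Qed.

Lemma is_derive_radial (H : R -> R) (dH : R) x i : x != 0 ->
  is_derive (enorm x) (1 : R) H dH ->
  is_derive x (delta_mx 0 i) (fun y => H (enorm y)) (dH * (x 0 i / enorm x)).
Proof.
move=> x0 HdH; apply/is_derive_line0.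
have /is_derive_line0 de := is_derive_enorm i x0.
apply: is_derive1_comp de.
by rewrite scale0r add0r.
Qed.

Lemma near_punctured x : x != 0 -> \forall y \near x, y != 0.
Proof.
move=> x0; have O : open (~` [set (0 : 'rV[R]_n)]).
  apply: closed_openC; apply: accessible_closed_set1.
  by apply: hausdorff_accessible; exact: norm_hausdorff.
have : nbhs x (~` [set (0 : 'rV[R]_n)]).
  by apply: open_nbhs_nbhs; split => //; exact/eqP.
by apply: filterS => y /eqP.
Qed.

Section profile.
Variables (F : 'rV[R]_n -> R) (H H1 : R -> R).
Hypothesis FH : forall y, y != 0 -> F y = H (enorm y).
Hypothesis HH1 : forall r : R, 0 < r -> is_derive r (1 : R) H (H1 r).

Lemma partial_radial x i : x != 0 ->
  partial i F x = H1 (enorm x) / enorm x * x 0 i.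
Proof.
move=> x0; rewrite /partial.
rewrite (@near_eq_derive _ _ _ _ (fun y => H (enorm y))).
  have := is_derive_radial i x0 (HH1 (enorm_gt0 x0)).
  by move=> -[_ ->]; rewrite mulrA mulrAC.
by apply: filterS (near_punctured x0) => y; exact: FH.
Qed.

Lemma dotp_grad_radial x : x != 0 -> dotp x (grad F x) = enorm x * H1 (enorm x).
Proof.
move=> x0; rewrite /dotp.
under eq_bigr => i _ do rewrite mxE partial_radial// mulrCA.
rewrite -mulr_sumr -/(dotp x x) -enorm_sqr.
by field; rewrite gt_eqF// enorm_gt0.
Qed.

(** By [partial_radial] the i-th partial derivative is G(|y|) y_i with
    G(s) = H1(s) / s, again a radial function times a coordinate; differentiating
    once more gives G'(r) x_i^2 / r + G(r), and the x_i^2 add up to r^2. *)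
Lemma laplacian_radial (H2 : R -> R) x : x != 0 ->
  (forall r : R, 0 < r -> is_derive r (1 : R) H1 (H2 r)) ->
  laplacian F x = H2 (enorm x) + (n%:R - 1) / enorm x * H1 (enorm x).
Proof.
move=> x0 HH2; have r0 := enorm_gt0 x0; rewrite /laplacian.
set r := enorm x in r0 *.
pose G s := H1 s / s.
have dG : is_derive r (1 : R) G (H2 r / r - H1 r / r ^+ 2).
  have h := is_deriveM (HH2 _ r0)
    (@is_deriveV _ id r 1 1 (lt0r_neq0 r0) (is_derive_id r (1 : R))).
  apply: (is_derive_eq h); rewrite /GRing.scale /=.
  by field; rewrite gt_eqF.
have dpart i : partial i (partial i F) x
    = (H2 r / r - H1 r / r ^+ 2) / r * (x 0 i * x 0 i) + H1 r / r.
  rewrite [LHS]/partial.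
  rewrite (@near_eq_derive _ _ _ _ (fun y => G (enorm y) * y 0 i)).
    have h := is_deriveM (is_derive_radial i x0 dG) (is_derive_coord x i i).
    rewrite (derive_val (is_derive := h)) eqxx /GRing.scale /=.
    by rewrite -/r /G; field; rewrite gt_eqF.
  by apply: filterS (near_punctured x0) => y; exact: partial_radial.
under eq_bigr => i _ do rewrite dpart.
rewrite big_split /= -mulr_sumr -/(dotp x x) -enorm_sqr -/r.
rewrite sumr_const card_ord -mulr_natr.
by field; rewrite gt_eqF.
Qed.

End profile.

End Radial.

(** * The radial equation *)

(** The profile is read off along a coordinate axis, where its derivatives are
    those of [f] in the direction of the axis. *)
Lemma radial_profile (R : realType) (n : nat) (f : 'rV[R]_n -> R) (i0 : 'I_n) :
  C2_on (@punctured R n) f -> radial_on (@punctured R n) f ->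
  exists h h1 h2 : R -> R,
    [/\ forall y, y != 0 -> f y = h (enorm y),
        forall r : R, 0 < r -> is_derive r (1 : R) h (h1 r) &
        forall r : R, 0 < r -> is_derive r (1 : R) h1 (h2 r)].
Proof.
move=> fC2 frad; pose e : 'rV[R]_n := delta_mx 0 i0.
have e0 (r : R) : 0 < r -> r *: e != 0 by exact: axis_neq0.
exists (fun r => f (r *: e)), (fun r => partial i0 f (r *: e)),
  (fun r => partial i0 (partial i0 f) (r *: e)).
split=> [y y0|r r0|r r0].
- apply: frad => //; first exact: e0 (enorm_gt0 y0).
  by rewrite enorm_axis// enorm_gt0.
- have [_ /(_ i0)[df _ _]] := fC2 _ (e0 _ r0).
  have := (@is_derive_line R _ _ f 0 e r (partial i0 f (r *: e))).2.
  under eq_fun do rewrite addr0.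
  by rewrite addr0; apply; split.
- have [_ /(_ i0)[_ _ /(_ i0)[df _]]] := fC2 _ (e0 _ r0).
  have := (@is_derive_line R _ _ (partial i0 f) 0 e r
    (partial i0 (partial i0 f) (r *: e))).2.
  under eq_fun do rewrite addr0.
  by rewrite addr0; apply; split.
Qed.

Lemma is_derive_powR_comp (R : realType) (g : R -> R) (dg a x : R) : 0 < g x ->
  is_derive x (1 : R) g dg ->
  is_derive x (1 : R) (fun s => g s `^ a) (a * g x `^ (a - 1) * dg).
Proof.
by move=> gx0 gdg; exact: is_derive1_comp (is_derive1_powR a gx0) gdg.
Qed.

(** The equation restricted to one variable.  Every radius is attained on an
    axis, which transfers positivity and the equation from [f] to [h]; [H1] and
    [H2] are the first two derivatives of h^m / m. *)
Lemma solution_profile (R : realType) (n : nat) (m alpha beta : R)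
    (f : 'rV[R]_n -> R) (i0 : 'I_n) : m != 0 ->
  is_solution m alpha beta f -> radial_on (@punctured R n) f ->
  exists h h1 H1 H2 : R -> R,
    [/\ forall y, y != 0 -> f y = h (enorm y),
        forall r : R, 0 < r -> 0 < h r /\ is_derive r (1 : R) h (h1 r),
        forall r : R, 0 < r ->
          is_derive r (1 : R) (fun s => h s `^ m / m) (H1 r),
        forall r : R, 0 < r -> is_derive r (1 : R) H1 (H2 r) &
        forall r : R, 0 < r ->
          H2 r + (n%:R - 1) / r * H1 r + alpha * h r + beta * (r * h1 r) = 0].
Proof.
move=> m0 [fC2 f_gt0 pde] frad.
have [h [h1 [h2 [fh dh dh1]]]] := radial_profile i0 fC2 frad.
have axis0 (r : R) : 0 < r -> exists2 y : 'rV[R]_n, y != 0 & enorm y = r.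
  move=> r0; exists (r *: delta_mx 0 i0); last exact: enorm_axis.
  exact: axis_neq0.
have h0 (r : R) : 0 < r -> 0 < h r.
  by move=> /axis0[y y0 <-]; rewrite -fh//; exact: f_gt0.
pose H1 r := h r `^ (m - 1) * h1 r.
pose H2 r := (m - 1) * h r `^ (m - 1 - 1) * h1 r * h1 r + h r `^ (m - 1) * h2 r.
have dH (r : R) : 0 < r -> is_derive r (1 : R) (fun s => h s `^ m / m) (H1 r).
  move=> r0.
  have d := is_deriveM (is_derive_powR_comp m (h0 _ r0) (dh _ r0))
    (is_derive_cst m^-1 r (1 : R)).
  apply: (is_derive_eq d); rewrite /GRing.scale /H1 /=.
  by field.
have dH1 (r : R) : 0 < r -> is_derive r (1 : R) H1 (H2 r).
  move=> r0.
  have d := is_deriveM (is_derive_powR_comp (m - 1) (h0 _ r0) (dh _ r0))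
    (dh1 _ r0).
  by apply: (is_derive_eq d); rewrite /GRing.scale /H2 /=; ring.
exists h, h1, H1, H2; split=> // r r0; first by split; [exact: h0|exact: dh].
have [y y0 yr] := axis0 _ r0.
have FH z : z != 0 -> f z `^ m / m = h (enorm z) `^ m / m by move=> /fh ->.
have := pde y y0.
rewrite (laplacian_radial (H := fun r => h r `^ m / m) FH dH y0 dH1).
by rewrite (dotp_grad_radial fh dh y0) fh// yr.
Qed.

(** The axis point e^t e_i tends to the origin without reaching it: this is how
    a limit at the origin becomes one at t = -oo. *)
Lemma cvg_axis_dnbhs (R : realType) (n : nat) (i0 : 'I_n) :
  (expR t *: delta_mx 0 i0 : 'rV[R]_n) @[t --> -oo] --> (0 : 'rV[R]_n)^'.
Proof.
have c : (expR t *: delta_mx 0 i0 : 'rV[R]_n) @[t --> -oo] --> (0 : 'rV[R]_n).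
  rewrite -(scale0r (delta_mx 0 i0)); apply: cvgZ; last exact: cvg_cst.
  have := @cvg_expRZ_ninfty R 1 ltr01.
  by under eq_fun do rewrite mul1r.
move=> A A0.
have cA : \forall t \near -oo,
    expR t *: delta_mx 0 i0 != 0 :> 'rV[R]_n -> A (expR t *: delta_mx 0 i0).
  exact: c _ A0.
suff : \forall t \near -oo, A (expR t *: delta_mx 0 i0) by [].
by apply: filterS cA => t; apply; apply: axis_neq0; exact: expR_gt0.
Qed.

Theorem corollary1p7 (R : realType) (n : nat) (m gamma eta alpha beta : R)
  (hn : (3 <= n)%N)
  (hm0 : 0 < m) (hm1 : m < (n%:R - 2) / n%:R)
  (hgamma0 : 0 < gamma) (hgamma : gamma != 2 / (1 - m))
  (heta : 0 < eta)
  (hbeta : beta != 0)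
  (halpha : alpha = (2 * beta + 1) / (1 - m))
  (hf : exists f : 'rV[R]_n -> R,
      [/\ is_solution m alpha beta f,
          radial_on (@punctured R n) f &
          enorm x `^ gamma * f x @[x --> (0 : 'rV[R]_n)^'] --> eta]) :
  0 < alpha /\ 0 < beta.
Proof.
have n0 : 0 < n%:R :> R by rewrite ltr0n; apply: leq_trans hn.
have mn : n%:R * m < n%:R - 2 by rewrite mulrC -ltr_pdivlMr.
have m1 : m < 1 by nra.
have [f [fsol frad flim]] := hf.
pose i0 := Ordinal (leq_trans (isT : (0 < 3)%N) hn).
have [h [h1 [H1 [H2 [fh dh dH dH1 ode]]]]] :=
  solution_profile i0 (lt0r_neq0 hm0) fsol frad.
have dexp (g : R -> R) (dg t : R) : is_derive (expR t) (1 : R) g dg ->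
    is_derive t (1 : R) (fun s => g (expR s)) (dg * expR t).
  by move=> d; exact: (is_derive1_comp d (is_derive_expR t)).
pose q t := h (expR t).
have q0 t : 0 < q t by exact: (dh _ (expR_gt0 t)).1.
have yY : expR (gamma * t) * q t @[t --> -oo] --> eta.
  have := cvg_comp _ _ (@cvg_axis_dnbhs R n i0) flim.
  apply: cvg_trans; apply: near_eq_cvg; apply: nearW => t /=.
  rewrite fh ?axis_neq0 ?expR_gt0//.
  by rewrite enorm_axis ?expR_gt0// /q /powR gt_eqF ?expR_gt0// expRK.
have wW : expR (gamma * m * t) * (q t `^ m / m) @[t --> -oo]
    --> eta `^ m / m.
  have -> : (fun t => expR (gamma * m * t) * (q t `^ m / m))
      = (fun t => (expR (gamma * t) * q t) `^ m / m).
    apply/funext => t; rewrite powRM ?expR_ge0 ?ltW//.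
    rewrite [expR (gamma * t) `^ m]/powR gt_eqF ?expR_gt0// expRK.
    by rewrite mulrA; congr (expR _ * _ / _); ring.
  have powRm_cont : {for eta, continuous (fun s : R => s `^ m)}.
    apply: differentiable_continuous; apply/derivable1_diffP.
    by case: (is_derive1_powR m heta).
  have ym : (expR (gamma * t) * q t) `^ m @[t --> -oo] --> eta `^ m.
    exact: continuous_cvg powRm_cont yY.
  exact: cvgM ym (cvg_cst _).
(* With r = e^t one has v' = r H1(r) and v'' = r^2 H2(r) + r H1(r), so the
   coefficient n - 1 of the radial equation becomes n - 2. *)
have [gam_gt alphaE] : 2 / (1 - m) < gamma /\ alpha = gamma * beta.
  apply: (@ode_exponents R (n%:R - 2) m gamma alpha beta _ _ q
    (fun t => h1 (expR t) * expR t) (fun t => q t `^ m / m)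
    (fun t => H1 (expR t) * expR t)
    (fun t => H2 (expR t) * expR t * expR t + H1 (expR t) * expR t)
    _ _ _ _ _ _ _ _ _ _ wW yY) => //.
  - by rewrite hm0.
  - lra.
  - by rewrite mulf_neq0 ?invr_eq0 ?gt_eqF// powR_gt0.
  - by rewrite gt_eqF.
  - by move=> t; apply: dexp; exact: (dh _ (expR_gt0 t)).2.
  - by move=> t; apply: (dexp (fun s => h s `^ m / m)); exact: dH (expR_gt0 t).
  - move=> t.
    have d := is_deriveM (dexp _ _ _ (dH1 _ (expR_gt0 t))) (is_derive_expR t).
    by apply: (is_derive_eq d); rewrite /GRing.scale /=; ring.
  - move=> t; have := ode _ (expR_gt0 t).
    have -> : expR (2 * t) = expR t * expR t by rewrite -expRD; congr expR; ring.
    rewrite -[in X in _ -> X](mulr0 (expR t * expR t)) => <-.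
    by rewrite /q; field; rewrite gt_eqF// expR_gt0.
have m10 : 0 < 1 - m by rewrite subr_gt0.
have bE : beta * (gamma * (1 - m) - 2) = 1.
  have : gamma * beta * (1 - m) = 2 * beta + 1.
    by rewrite -alphaE halpha divfK// gt_eqF.
  lra.
have b0 : 0 < beta.
  move: gam_gt; rewrite ltr_pdivrMr// => ?; nra.
by split => //; rewrite alphaE mulr_gt0.
Qed.
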